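(* Let $p \equiv 5 \pmod 8$ be a prime and let $\chi$ be a Dirichlet character modulo $p$ of exact order $4$. Consider the two identities $$\text{(I)}\quad \sum_{j=0}^n \delta_\chi(j)\,\delta_{\overline{\chi}}(n-j) = \alpha\, \sigma'_p(n) \quad\text{for all } n\ge 0, \text{ for some } \alpha\in\mathbb{R},$$ $$\text{(II)}\quad \sum_{j=0}^n \delta_\chi(j)\,\delta_{\chi}(n-j) = \alpha'\, \tilde\sigma_p(n)+\beta'\,\hat\sigma_p(n) \quad\text{for all } n\ge 0, \text{ for some } \alpha',\beta'\in\mathbb{C}.$$ The identities (I) and (II) hold if and only if $p=5$ or $p=13$. Specifically, if $p=5$ then for all $n\ge 0$ $$\sum_{j=0}^n \delta_\chi(j)\delta_{\overline\chi}(n-j)=\tfrac{3}{5}\sigma'_p(n),\qquad \sum_{j=0}^n \delta_\chi(j)\delta_\chi(n-j)=-\tfrac{4+3\chi(2)}{10}\tilde\sigma_p(n)+\tfrac{2+\chi(2)}{2}\hat\sigma_p(n),$$ and if $p=13$ then for all $n\ge0$ $$\sum_{j=0}^n \delta_\chi(j)\delta_{\overline\chi}(n-j)=\sigma'_p(n),\qquad \sum_{j=0}^n \delta_\chi(j)\delta_\chi(n-j)=-\tfrac{\chi(2)}{2}\tilde\sigma_p(n)+\tfrac{2+3\chi(2)}{2}\hat\sigma_p(n).$$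
   Context: The bar denotes complex conjugation. For a Dirichlet character $\chi$ modulo $p$: $\delta_\chi(n)=\sum_{0<d\mid n}\chi(d)$ for $n>0$, and $\delta_\chi(0)=-\frac{1}{2p}\sum_{a=1}^{p-1}\chi(a)a$. Further, $\sigma'_p(n)=\sum_{0<d\mid n,\ p\nmid d} d$ for $n>0$ and $\sigma'_p(0)=\frac{p-1}{24}$; $\tilde\sigma_p(n)=\sum_{0<d\mid n}\left(\frac{p}{d}\right)d$ for $n>0$ and $\tilde\sigma_p(0)=-\frac14 B_{2,\psi}$; $\hat\sigma_p(n)=\sum_{0<d\mid n}\left(\frac{p}{d}\right)\frac nd$ for $n>0$ and $\hat\sigma_p(0)=0$. Here $\left(\frac{p}{\cdot}\right)$ is the Kronecker symbol, $\psi=\chi^2=\left(\frac{p}{\cdot}\right)$ is the quadratic character modulo $p$, and $B_{2,\psi}$ is the generalized Bernoulli number attached to $\psi$. *)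

(* Defs.v *)
From HB Require Import structures.
From mathcomp Require Import all_boot all_order all_algebra.
From mathcomp Require Import reals complex.

Set Implicit Arguments.
Unset Strict Implicit.
Unset Printing Implicit Defensive.

Import Order.TTheory GRing.Theory Num.Theory.
Local Open Scope ring_scope.

Record dirichlet_character (C : fieldType) (f : nat) (chi : int -> C) : Prop :=
  DirichletCharacter {
    dchar_periodic : forall n, chi (n + f%:Z) = chi n;
    dchar_mul : forall m n, chi (m * n) = chi m * chi n;
    dchar_support : forall n, (chi n != 0) = coprimez n f%:Z }.

Definition principal_char (C : fieldType) (f : nat) (n : int) : C :=
  (coprimez n f%:Z)%:R.

Definition dchar_order (C : fieldType) (f : nat) (chi : int -> C) (k : nat) :
    Prop :=
  [/\ (0 < k)%N,
      forall n, chi n ^+ k = principal_char C f n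
    & forall m, (0 < m < k)%N -> ~ forall n, chi n ^+ m = principal_char C f n].

Definition legendre (a q : nat) : int :=
  if (q %| a)%N then 0
  else if [exists x : 'I_q, (x ^ 2 == a %[mod q])%N] then 1 else -1.

Definition kronecker_prime (a q : nat) : int :=
  if q != 2%N then legendre a q
  else if ~~ odd a then 0
  else if (a %% 8 == 1)%N || (a %% 8 == 7)%N then 1 else -1.

(* The Kronecker symbol (a / n) for natural numbers a and n. *)
Definition kronecker (a n : nat) : int :=
  if n == 0%N then (a == 1%N)%:R
  else \prod_(q <- primes n) kronecker_prime a q ^+ logn q n.

(* The first n Bernoulli numbers, in the convention B_1 = -1/2. *)
Fixpoint bernoulli_seq (F : numFieldType) (n : nat) : seq F :=
  if n is m.+1 then
    let s := bernoulli_seq F m in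
    rcons s (((m == 0%N)%:R - \sum_(k < m) 'C(m.+1, k)%:R * s`_k) / m.+1%:R)
  else [::].

Definition bernoulli (F : numFieldType) (n : nat) : F :=
  (bernoulli_seq F n.+1)`_n.

Definition bernoulli_poly (F : numFieldType) (n : nat) : {poly F} :=
  \sum_(k < n.+1) ('C(n, k)%:R * bernoulli F k) *: 'X^(n - k).

(* B_{k,psi} = f^(k-1) sum_{a=1}^f psi(a) B_k(a/f), for psi of modulus f. *)
Definition gen_bernoulli (F : numFieldType) (k f : nat) (psi : nat -> F) : F :=
  f%:R ^+ k / f%:R *
    \sum_(1 <= a < f.+1) psi a * (bernoulli_poly F k).[a%:R / f%:R].

Definition delta (C : numFieldType) (p : nat) (chi : int -> C) (n : nat) : C :=
  if n == 0%N then - (1 / (2 * p%:R)) * \sum_(1 <= a < p) chi a%:Z * a%:R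
  else \sum_(d <- divisors n) chi d%:Z.

Definition sigma' (C : numFieldType) (p n : nat) : C :=
  if n == 0%N then (p%:R - 1) / 24
  else \sum_(d <- divisors n | ~~ (p %| d)%N) d%:R.

Definition sigma_tilde (C : numFieldType) (p n : nat) : C :=
  if n == 0%N then
    - (1 / 4) * gen_bernoulli 2 p (fun a => (kronecker p a)%:~R)
  else \sum_(d <- divisors n) (kronecker p d)%:~R * d%:R.

Definition sigma_hat (C : numFieldType) (p n : nat) : C :=
  if n == 0%N then 0
  else \sum_(d <- divisors n) (kronecker p d)%:~R * (n %/ d)%N%:R.

Lemma size_bernoulli_seq (F : numFieldType) n : size (bernoulli_seq F n) = n.
Proof. by elim: n => //= n IHn; rewrite size_rcons IHn. Qed.

Lemma bernoulli_seqE (F : numFieldType) n k : (k < n)%N ->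
  (bernoulli_seq F n)`_k = bernoulli F k.
Proof.
elim: n => // n IHn; rewrite ltnS leq_eqVlt => /orP[/eqP-> //|kn].
by rewrite /= nth_rcons size_bernoulli_seq kn IHn.
Qed.

Lemma bernoulli_rec (F : numFieldType) n :
  \sum_(k < n.+1) 'C(n.+1, k)%:R * bernoulli F k = (n == 0%N)%:R.
Proof.
rewrite big_ord_recr /= binSn {2}/bernoulli /= nth_rcons size_bernoulli_seq.
rewrite ltnn eqxx [n.+1%:R * _]mulrC divfK ?pnatr_eq0 //.
under [X in _ + (_ - X)]eq_bigr => k _ do rewrite bernoulli_seqE //.
by rewrite addrC subrK.
Qed.

(* Main.v *)
Require Import Defs.
From mathcomp Require Import all_boot all_order all_algebra.
From mathcomp Require Import all_fingroup cyclic pgroup finfield.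
From mathcomp Require Import reals complex.
From mathcomp Require Import zify ring.

Set Implicit Arguments.
Unset Strict Implicit.
Unset Printing Implicit Defensive.

Import Order.TTheory GRing.Theory Num.Theory.
Local Open Scope ring_scope.

(** If (I) holds, its coefficients at n = 0, ..., 3 together with
    chi(2)^2 = -1 and chi(3)^4 = 1 leave alpha = 1, 3/5 or 1/2, that is
    p = 13, 5 or 4.

    Conversely, the nonconstant part of each convolution is a sum of
    chi(a) chi'(b) over a x + b y = n.  Let phi be an even function of pairs
    modulo p with phi(u, v) = phi(v, - u - v).  Splitting the solutions
    according to x < y, x = y, x > y and performing one step of Euclid's
    algorithm on the pair (x, y) gives
      sum (phi(a, b) - phi(a, -b))
      = sum_(d | n) (sum_(0 < a < d) phi(a, d - a) - (n/d - 1) phi(d, -d)).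
    For p = 5 and p = 13 there are such phi, homogeneous in (a, b) and hence
    given by a table on the projective line, for which phi(a, b) - phi(a, -b)
    symmetrises to chi(a) chi'(b); the right-hand side then is the wanted
    divisor sum by a finite computation with Gaussian integers.  The Kronecker
    symbol is identified with chi^2 by quadratic reciprocity. *)

(** * Reindexing the positive solutions of a x + b y = n *)

(** [f] and [g] need to be mutually inverse only between the filtered list and [s]; elsewhere
    truncated subtraction and division may break the bijection. *)
Lemma perm_map_filter (S T : eqType) (f : S -> T) (g : T -> S) (P : pred S) L s :
  uniq L -> uniq s ->
  (forall q, q \in L -> P q -> f q \in s /\ g (f q) = q) ->
  (forall t, t \in s -> [/\ g t \in L, P (g t) & f (g t) = t]) ->
  perm_eq (map f (filter P L)) s.
Proof.
move=> uL us fs gs; apply: uniq_perm => //.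
  rewrite map_inj_in_uniq ?filter_uniq // => q r.
  rewrite !mem_filter => /andP[Pq qn] /andP[Pr rn] efqr.
  by rewrite -(fs q qn Pq).2 efqr (fs r rn Pr).2.
move=> t; apply/mapP/idP => [[q]|ts].
  by rewrite mem_filter => /andP[Pq qn] ->; rewrite (fs q qn Pq).1.
by have [gq Pg fg] := gs t ts; exists (g t); rewrite ?mem_filter ?Pg ?gq.
Qed.

(** A solution is stored as ((a, b), (x, y)). The range 1, ..., n loses none, since each factor is
    at most its product. *)
Definition quads (n : nat) : seq ((nat * nat) * (nat * nat)) :=
  let s := iota 1 n in
  [seq q <- [seq (u, v) | u <- [seq (a, b) | a <- s, b <- s],
                          v <- [seq (x, y) | x <- s, y <- s]]
     | q.1.1 * q.2.1 + q.1.2 * q.2.2 == n]%N.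

Lemma mem_quads n a b x y :
  (((a, b), (x, y)) \in quads n) =
  [&& 0 < a, 0 < b, 0 < x, 0 < y & a * x + b * y == n]%N.
Proof.
rewrite mem_filter /= andbC.
have inj2 (T1 T2 : eqType) (s : seq T1) (t : seq T2) u v :
    ((u, v) \in [seq (u', v') | u' <- s, v' <- t]) = (u \in s) && (v \in t).
  apply/allpairsP/andP => [[[u' v'] [? ? [-> ->]]] // | [us vt]].
  by exists (u, v).
rewrite !inj2 !mem_iota; apply/idP/idP => [|/and5P[a0 b0 x0 y0 /eqP en]].
  by case/andP=> /andP[/andP[/andP[-> _] /andP[-> _]] /andP[/andP[-> _] /andP[-> _]]].
have : (a <= a * x /\ x <= a * x /\ b <= b * y /\ y <= b * y)%N.
  by rewrite !leq_pmulr ?leq_pmull.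
by rewrite en eqxx a0 b0 x0 y0 /=; lia.
Qed.

Lemma uniq_quads n : uniq (quads n).
Proof.
have pair_uniq (T1 T2 : eqType) (s : seq T1) (t : seq T2) :
    uniq s -> uniq t -> uniq [seq (u, v) | u <- s, v <- t].
  by move=> us ut; apply: allpairs_uniq => // -[? ?] [? ?] _ _ [-> ->].
rewrite /quads filter_uniq //.
by rewrite !pair_uniq ?iota_uniq.
Qed.

Section QuadSums.
Variable V : zmodType.
Implicit Types phi : nat -> nat -> V.

Lemma quads_swap n phi :
  \sum_(q <- quads n) phi q.1.1 q.1.2 = \sum_(q <- quads n) phi q.1.2 q.1.1.
Proof.
pose f (q : (nat * nat) * (nat * nat)) := ((q.1.2, q.1.1), (q.2.2, q.2.1)).
have fK : involutive f by case=> [[? ?] [? ?]].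
have fQ q : q \in quads n -> f q \in quads n.
  by case: q => [[a b] [x y]]; rewrite !mem_quads => /and5P[-> -> -> -> /eqP <-] /=; apply/eqP; lia.
have: perm_eq (map f (filter predT (quads n))) (quads n).
  apply: (@perm_map_filter _ _ f f) => [||q qn _|q qn]; rewrite ?uniq_quads ?fK //.
    by split; [exact: fQ|].
  by split=> //; exact: fQ.
by rewrite filter_predT => /(perm_big _) <-; rewrite big_map.
Qed.

(** The map (a, b, x, y) -> (a, a + b, x - y, y) preserves the equation, as a (x - y) + (a + b) y =
    a x + b y, and trades the condition x > y for a < b. *)
Lemma quads_lt n phi :
  \sum_(q <- quads n | (q.2.2 < q.2.1)%N) phi q.1.1 q.1.2
  = \sum_(q <- quads n | (q.1.1 < q.1.2)%N) phi q.1.1 (q.1.2 - q.1.1)%N.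
Proof.
pose f (q : (nat * nat) * (nat * nat)) :=
  ((q.1.1, q.1.1 + q.1.2), (q.2.1 - q.2.2, q.2.2))%N.
pose g (q : (nat * nat) * (nat * nat)) :=
  ((q.1.1, q.1.2 - q.1.1), (q.2.1 + q.2.2, q.2.2))%N.
pose lt12 (q : (nat * nat) * (nat * nat)) := (q.1.1 < q.1.2)%N.
rewrite -[LHS]big_filter -[RHS]big_filter.
have /(perm_big _) <- : perm_eq
    (map f (filter (fun q => (q.2.2 < q.2.1)%N) (quads n)))
    (filter lt12 (quads n)).
  apply: (@perm_map_filter _ _ f g); [exact: uniq_quads|exact: (filter_uniq _ (uniq_quads n))|..].
    move=> [[a b] [x y]]; rewrite (mem_filter lt12) /f /g /lt12 /= !mem_quads.
    move=> /and5P[a0 b0 x0 y0 /eqP <-] yx; split.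
      by apply/andP; split; [lia|]; apply/and5P; split; [lia..|nia].
    by congr ((_, _), (_, _)); lia.
  move=> [[a b] [x y]]; rewrite (mem_filter lt12) /f /g /lt12 /= !mem_quads.
  move=> /andP[ab /and5P[a0 b0 x0 y0 /eqP <-]]; split; [apply/and5P; split; [lia..|nia] | lia |].
  by congr ((_, _), (_, _)); lia.
by rewrite big_map; apply: eq_bigr => q _; rewrite addKn.
Qed.

Lemma quads_gt n phi :
  \sum_(q <- quads n | (q.2.1 < q.2.2)%N) phi q.1.1 q.1.2
  = \sum_(q <- quads n | (q.1.2 < q.1.1)%N) phi (q.1.1 - q.1.2)%N q.1.2.
Proof.
pose f (q : (nat * nat) * (nat * nat)) :=
  ((q.1.1 + q.1.2, q.1.2), (q.2.1, q.2.2 - q.2.1))%N.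
pose g (q : (nat * nat) * (nat * nat)) :=
  ((q.1.1 - q.1.2, q.1.2), (q.2.1, q.2.1 + q.2.2))%N.
pose lt21 (q : (nat * nat) * (nat * nat)) := (q.1.2 < q.1.1)%N.
rewrite -[LHS]big_filter -[RHS]big_filter.
have /(perm_big _) <- : perm_eq
    (map f (filter (fun q => (q.2.1 < q.2.2)%N) (quads n)))
    (filter lt21 (quads n)).
  apply: (@perm_map_filter _ _ f g); [exact: uniq_quads|exact: (filter_uniq _ (uniq_quads n))|..].
    move=> [[a b] [x y]]; rewrite (mem_filter lt21) /f /g /lt21 /= !mem_quads.
    move=> /and5P[a0 b0 x0 y0 /eqP <-] yx; split.
      by apply/andP; split; [lia|]; apply/and5P; split; [lia..|nia].
    by congr ((_, _), (_, _)); lia.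
  move=> [[a b] [x y]]; rewrite (mem_filter lt21) /f /g /lt21 /= !mem_quads.
  move=> /andP[ab /and5P[a0 b0 x0 y0 /eqP <-]]; split; [apply/and5P; split; [lia..|nia] | lia |].
  by congr ((_, _), (_, _)); lia.
by rewrite big_map; apply: eq_bigr => q _; rewrite addnK.
Qed.

(** On x = y the equation reads (a + b) x = n, so d = a + b divides n and a runs freely below d. *)
Lemma quads_diag_xy n phi : (0 < n)%N ->
  \sum_(q <- quads n | q.2.1 == q.2.2) phi q.1.1 q.1.2
  = \sum_(d <- divisors n) \sum_(1 <= a < d) phi a (d - a)%N.
Proof.
move=> n0; rewrite -[LHS]big_filter.
pose f (q : (nat * nat) * (nat * nat)) := (q.1.1 + q.1.2, q.1.1)%N.
pose g (q : nat * nat) := ((q.2, q.1 - q.2), (n %/ q.1, n %/ q.1))%N.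
pose s := [seq (d, a) | d <- divisors n, a <- index_iota 1 d].
have sE d a : ((d, a) \in s) = [&& (d %| n), 0 < a & a < d]%N.
  apply/allpairsPdep/idP => [[d' [a' [+ + [-> ->]]]]|/and3P[dn a0 ad]].
    by rewrite -dvdn_divisors // mem_index_iota => -> /andP[-> ->].
  by exists d, a; rewrite -dvdn_divisors // mem_index_iota dn a0 ad.
have us : uniq s.
  apply: allpairs_uniq_dep => [|d _|[d a] [d' a'] _ _ [-> ->] //].
    exact: divisors_uniq.
  exact: iota_uniq.
have /(perm_big _) E : perm_eq
    (map f (filter (fun q => q.2.1 == q.2.2) (quads n))) s.
  apply: (@perm_map_filter _ _ f g) => //; first exact: uniq_quads.
    move=> [[a b] [x y]]; rewrite /f /g /= sE mem_quads.
    move=> /and5P[a0 b0 x0 y0 /eqP <-] /eqP xy; rewrite -xy -mulnDl; split.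
      by rewrite dvdn_mulr //=; lia.
    by rewrite mulKn ?addn_gt0 ?a0 // addKn.
  move=> [d a]; rewrite sE /f /g /= mem_quads => /and3P[dn a0 ad].
  have q0 : (0 < n %/ d)%N.
    by rewrite divn_gt0 ?(dvdn_leq n0 dn) // (leq_ltn_trans _ ad).
  split=> //; last by rewrite subnKC // ltnW.
  by rewrite a0 q0 subn_gt0 ad -mulnDl subnKC ?(ltnW ad) // mulnC divnK //=.
transitivity (\sum_(i <- s) phi i.2 (i.1 - i.2)%N).
  by rewrite -E big_map; apply: eq_bigr => q _; rewrite /= addKn.
by rewrite big_allpairs_dep.
Qed.

(** On a = b = d the equation reads x + y = n / d, which has n / d - 1 positive solutions. *)
Lemma quads_diag_ab n (psi : nat -> V) : (0 < n)%N ->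
  \sum_(q <- quads n | q.1.1 == q.1.2) psi q.1.1
  = \sum_(d <- divisors n) psi d *+ (n %/ d).-1.
Proof.
move=> n0; rewrite -[LHS]big_filter.
pose f (q : (nat * nat) * (nat * nat)) := (q.1.1, q.2.1)%N.
pose g (q : nat * nat) := ((q.1, q.1), (q.2, n %/ q.1 - q.2))%N.
pose s := [seq (d, x) | d <- divisors n, x <- index_iota 1 (n %/ d)].
have sE d x : ((d, x) \in s) = [&& (d %| n), 0 < x & x < n %/ d]%N.
  apply/allpairsPdep/idP => [[d' [a' [+ + [-> ->]]]]|/and3P[dn a0 ad]].
    by rewrite -dvdn_divisors // mem_index_iota => -> /andP[-> ->].
  by exists d, x; rewrite -dvdn_divisors // mem_index_iota dn a0 ad.
have us : uniq s.
  apply: allpairs_uniq_dep => [|d _|[d a] [d' a'] _ _ [-> ->] //].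
    exact: divisors_uniq.
  exact: iota_uniq.
have /(perm_big _) E : perm_eq
    (map f (filter (fun q => q.1.1 == q.1.2) (quads n))) s.
  apply: (@perm_map_filter _ _ f g) => //; first exact: uniq_quads.
    move=> [[a b] [x y]]; rewrite /f /g /= sE mem_quads.
    move=> /and5P[a0 b0 x0 y0 /eqP <-] /eqP xy; rewrite -xy -mulnDr mulKn //; split.
      by rewrite dvdn_mulr //=; lia.
    by rewrite addKn.
  move=> [d x]; rewrite sE /f /g /= mem_quads => /and3P[dn x0 xd].
  have d0 : (0 < d)%N by exact: dvdn_gt0 dn.
  split=> //.
  by rewrite d0 x0 subn_gt0 xd -mulnDr subnKC ?(ltnW xd) // mulnC divnK //=.
transitivity (\sum_(i <- s) psi i.1); first by rewrite -E big_map.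
rewrite big_allpairs_dep; apply: eq_bigr => d _ /=.
by rewrite sumr_const_nat subn1.
Qed.

(* Euclid's step (a, b, x, y) -> (a, a + b, x - y, y) for x > y, and its mirror
   image for x < y, trade the order of x, y for the order of a, b; the two
   hypotheses make both images of phi equal to the single function phi'. *)
Lemma quads_three_term n phi phi' : (0 < n)%N ->
  (forall a b, phi a b = phi' (a + b)%N a) ->
  (forall a b, phi a b = phi' b (a + b)%N) ->
  \sum_(q <- quads n) (phi q.1.1 q.1.2 - phi' q.1.1 q.1.2)
  = \sum_(d <- divisors n)
      (\sum_(1 <= a < d) phi a (d - a)%N - phi' d d *+ (n %/ d).-1).
Proof.
move=> n0 phil phir.
(* Swapping a and b in the sum of [phi'] gives its off-diagonal terms the form [phi' b a] that the
   Euclidean steps produce, so that they cancel. *)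
rewrite sumrB [X in _ - X]quads_swap sumrB -quads_diag_xy // -quads_diag_ab //.
have split3 (P Q : nat * nat * (nat * nat) -> nat) F :
    \sum_(q <- quads n) F q = \sum_(q <- quads n | P q == Q q) F q
      + \sum_(q <- quads n | (P q < Q q)%N) F q
      + \sum_(q <- quads n | (Q q < P q)%N) F q :> V.
  rewrite (bigID (fun q => P q == Q q)) /= -addrA; congr (_ + _).
  rewrite (bigID (fun q => (P q < Q q)%N)) /=; congr (_ + _); apply: eq_bigl => q; lia.
rewrite (split3 (fun q => q.2.1) (fun q => q.2.2)) quads_lt quads_gt.
rewrite (split3 (fun q => q.1.1) (fun q => q.1.2) (fun q => phi' q.1.2 q.1.1)).
have -> : \sum_(q <- quads n | (q.1.1 < q.1.2)%N) phi q.1.1 (q.1.2 - q.1.1)%N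
    = \sum_(q <- quads n | (q.1.1 < q.1.2)%N) phi' q.1.2 q.1.1.
  by apply: eq_bigr => q lt; rewrite phil subnKC // ltnW.
have -> : \sum_(q <- quads n | (q.1.2 < q.1.1)%N) phi (q.1.1 - q.1.2)%N q.1.2
    = \sum_(q <- quads n | (q.1.2 < q.1.1)%N) phi' q.1.2 q.1.1.
  by apply: eq_bigr => q lt; rewrite phir subnK // ltnW.
have -> : \sum_(q <- quads n | q.1.1 == q.1.2) phi' q.1.2 q.1.1
    = \sum_(q <- quads n | q.1.1 == q.1.2) phi' q.1.1 q.1.1.
  by apply: eq_bigr => q /eqP ->.
have cancel2 (x y z w : V) : x + w + z - (y + z + w) = x - y.
  rewrite [x + w + z]addrAC; by rewrite -(addrA x) -(addrA y) [y + _]addrC addrKA.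
exact: cancel2.
Qed.

End QuadSums.

(** * Convolutions of divisor sums as sums over solutions *)

(** A divisor d of j and a divisor e of n - j amount to the solution d x + e y = n with d x = j. *)
Lemma quads_conv (C : comPzRingType) n (g h : nat -> C) : (0 < n)%N ->
  \sum_(1 <= j < n) (\sum_(d <- divisors j) g d) * (\sum_(e <- divisors (n - j)) h e)
  = \sum_(q <- quads n) g q.1.1 * h q.1.2.
Proof.
move=> n0.
pose f (q : (nat * nat) * (nat * nat)) := (q.1.1 * q.2.1, (q.1.1, q.1.2))%N.
pose k (t : nat * (nat * nat)) :=
  ((t.2.1, t.2.2), (t.1 %/ t.2.1, (n - t.1) %/ t.2.2))%N.
pose s := [seq (j, u) | j <- index_iota 1 n,
             u <- [seq (d, e) | d <- divisors j, e <- divisors (n - j)]].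
have sE j d e : ((j, (d, e)) \in s) =
    [&& 0 < j, j < n, d %| j & e %| n - j]%N.
  apply/allpairsPdep/idP => [[j' [u [Hj Hu [-> Eu]]]]|/and4P[j0 jn dj ej]].
    move: Hj Hu; rewrite -Eu mem_index_iota => /andP[j0 jn] /allpairsP[[d' e'] [/= + + [-> ->]]].
    by rewrite -!dvdn_divisors ?subn_gt0 // j0 jn => -> ->.
  exists j, (d, e); rewrite mem_index_iota j0 jn; split=> //.
  by apply/allpairsP; exists (d, e); rewrite -!dvdn_divisors ?subn_gt0.
have us : uniq s.
  apply: allpairs_uniq_dep => [|j _|[d a] [d' a'] _ _ [-> ->] //].
    exact: iota_uniq.
  by apply: allpairs_uniq; rewrite ?divisors_uniq // => -[? ?] [? ?] _ _ [-> ->].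
have /(perm_big _) E : perm_eq (map f (filter predT (quads n))) s.
  apply: (@perm_map_filter _ _ f k) => //; first exact: uniq_quads.
    move=> [[a b] [x y]]; rewrite /f /k /= sE mem_quads.
    move=> /and5P[a0 b0 x0 y0 /eqP <-] _; rewrite addKn !mulKn ?dvdn_mulr //.
    by rewrite !muln_gt0 a0 x0 -[X in (X < _)%N]addn0 ltn_add2l muln_gt0 b0 y0.
  move=> [j [d e]]; rewrite sE /f /k /= mem_quads => /and4P[j0 jn dj ej].
  have d0 := dvdn_gt0 j0 dj; have nj0 : (0 < n - j)%N by rewrite subn_gt0.
  have e0 := dvdn_gt0 nj0 ej.
  split=> //; last by rewrite mulnC divnK.
  rewrite d0 e0 !divn_gt0 ?(dvdn_leq _ dj) ?(dvdn_leq _ ej) //.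
  by rewrite mulnC divnK // [(e * _)%N]mulnC divnK // subnKC //= ltnW.
transitivity (\sum_(t <- s) g t.2.1 * h t.2.2).
  rewrite big_allpairs_dep; apply: eq_bigr => j _.
  by rewrite big_allpairs_dep big_distrl; apply: eq_bigr => d _; rewrite big_distrr.
by rewrite -E big_map filter_predT.
Qed.

(** The terms j = 0 and j = n carry the constant terms and give the single divisor sum; the others
    give the sum over [quads]. *)
Lemma delta_conv (C : numFieldType) p (chi chi' : int -> C) n : (0 < n)%N ->
  \sum_(j < n.+1) delta p chi j * delta p chi' (n - j)%N
  = \sum_(d <- divisors n) (delta p chi 0 * chi' d%:Z + delta p chi' 0 * chi d%:Z)
    + \sum_(q <- quads n) chi q.1.1%:Z * chi' q.1.2%:Z.
Proof.
move=> n0; rewrite -(quads_conv (fun a => chi a%:Z) (fun a => chi' a%:Z)) //.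
rewrite -(big_mkord predT (fun j => delta p chi j * delta p chi' (n - j)%N)).
rewrite big_nat_recr //= big_ltn // subn0 subnn.
have dE g m : (0 < m)%N -> delta p g m = \sum_(d <- divisors m) g d%:Z :> C.
  by rewrite /delta; case: m.
rewrite big_split /= -!mulr_sumr -!dE // addrAC [delta p chi n * _]mulrC.
congr (_ + _); rewrite !big_nat; apply: eq_bigr => j /andP[j0 jn].
by rewrite !dE ?subn_gt0.
Qed.

(** * Finite certificates over the Gaussian integers *)

(* A pair (x, y) stands for the Gaussian integer x + y I. *)
Definition gint := (int * int)%type.
Definition gadd (z w : gint) : gint := (z.1 + w.1, z.2 + w.2).
Definition gopp (z : gint) : gint := (- z.1, - z.2).
Definition gmul (z w : gint) : gint :=
  (z.1 * w.1 - z.2 * w.2, z.1 * w.2 + z.2 * w.1).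
Definition gconj (z : gint) : gint := (z.1, - z.2).
Definition gint_of (m : int) : gint := (m, 0).
(** A plain fold, so that [vm_compute] evaluates it. *)
Definition gsum (F : nat -> gint) (s : seq nat) : gint :=
  foldr (fun a z => gadd (F a) z) (0, 0) s.

(* A character with value I at 2, provided 2 is a primitive root modulo p. *)
Definition quartic (p d : nat) : gint :=
  if (p %| d)%N then (0, 0) else
  let k := find (fun k => 2 ^ k == d %[mod p])%N (iota 0 p.-1) in
  nth (0, 0) [:: (1, 0); (0, 1); (-1, 0); (0, -1)] (k %% 4).

(** The square of a fourth root of unity is real, so the first component loses nothing. *)
Definition quad_char (p d : nat) : int :=
  (gmul (quartic p d) (quartic p d)).1.

Definition triv_char (p d : nat) : int := (~~ (p %| d)%N)%:R.

(* (a, b) |-> s(a) f(b / a), with f(oo) = f(0) = f(-1) by cyclic invariance. *)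
Definition hom_table (p : nat) (s : nat -> int) (f : seq gint) (a b : nat) : gint :=
  if (p %| a)%N then gmul (gint_of (s b)) (nth (0, 0) f 0)
  else let c := find (fun c => a * c == b %[mod p])%N (iota 0 p) in
    gmul (gint_of (s a)) (nth (0, 0) f c).

(* T is 2 phi, T' a b is 2 phi(a, -b), and A / 2p, - B / 2 are the coefficients
   of the two divisor sums. *)
Definition quartic_cert (p : nat) (X Y : nat -> gint) (s : nat -> int)
    (f : seq gint) (A B : gint) : bool :=
  let T := hom_table p s f in
  let T' a b := T a (p - b)%N in
  let c Z := gsum (fun a => gmul (Z a) (gint_of a%:Z)) (iota 1 p.-1) in
  [&& all (fun a => all (fun b =>
        [&& T a b == T' ((a + b) %% p)%N a,
            T a b == T' b ((a + b) %% p)%N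
          & gadd (gadd (T a b) (gopp (T' a b))) (gadd (T b a) (gopp (T' b a)))
            == gmul (gint_of 2) (gadd (gmul (X a) (Y b)) (gmul (X b) (Y a)))])
        (iota 0 p)) (iota 0 p),
      all (fun a => T' a a == gmul B (gint_of (s a))) (iota 0 p),
      all (fun d =>
        gadd (gmul (gint_of p%:Z)
               (gadd (gsum (fun a => T a (d - a)%N) (iota 1 d.-1))
                     (T' (d %% p)%N (d %% p)%N)))
             (gopp (gadd (gmul (c X) (Y d)) (gmul (c Y) (X d))))
        == gmul A (gint_of (s d * d%:Z))) (iota 1 p)
    & all (fun r => gsum (fun a => T a ((r + p - a) %% p)%N) (iota 0 p)
        == gmul A (gint_of (s r))) (iota 0 p)].

(** Entry c is 2 phi(1, c); the weight s is the trivial character for (I) and chi^2 for (II). *)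
Definition table_I5 : seq gint :=
  [:: (0, 0); (2, 0); (2, 0); (2, 0); (0, 0)].
Definition table_II5 : seq gint :=
  [:: (-2, -1); (0, -1); (0, 1); (0, -1); (-2, -1)].
Definition table_I13 : seq gint :=
  [:: (0, 0); (2, 0); (2, 0); (4, 0); (2, 0); (2, 0); (2, 0); (2, 0); (2, 0);
      (4, 0); (2, 0); (2, 0); (0, 0)].
Definition table_II13 : seq gint :=
  [:: (-2, -3); (0, -3); (0, -1); (2, -1); (0, -1); (0, 1); (0, 3); (0, 1);
      (0, -1); (2, -1); (0, -1); (0, -3); (-2, -3)].

Definition cquartic p d := gconj (quartic p d).


Section Evaluation.
Variables (C : numFieldType) (I : C).
Hypothesis sqrI : I * I = -1.

(** The ring morphism from Z[i] sending i to I. Taking I = chi(2) covers both quartic characters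
    with one certificate. *)
Definition geval (z : gint) : C := z.1%:~R + z.2%:~R * I.

Lemma geval0 : geval (0, 0) = 0.
Proof. by rewrite /geval mul0r addr0. Qed.

Lemma gevalD z w : geval (gadd z w) = geval z + geval w.
Proof. by rewrite /geval /gadd /= !intrD; ring. Qed.

Lemma gevalN z : geval (gopp z) = - geval z.
Proof. by rewrite /geval /gopp /= !intrN; ring. Qed.

Lemma gevalM z w : geval (gmul z w) = geval z * geval w.
Proof.
by rewrite /geval /gmul /= intrB intrD !intrM; ring: sqrI.
Qed.

Lemma geval_int m : geval (gint_of m) = m%:~R.
Proof. by rewrite /geval mul0r addr0. Qed.

Lemma geval_sum F s : geval (gsum F s) = \sum_(a <- s) geval (F a).
Proof.
elim: s => [|a s IHs]; first by rewrite big_nil geval0.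
by rewrite big_cons /= gevalD IHs.
Qed.

End Evaluation.

Lemma sum_periodic_shift (V : zmodType) p (F : nat -> V) d : (forall a, F (a + p)%N = F a) ->
  \sum_(d <= a < d + p) F a = \sum_(0 <= a < p) F a.
Proof.
move=> Fp; elim: d => [|d IHd]; first by rewrite add0n.
have [->|p0] := posnP p; first by rewrite !addn0 !big_geq.
rewrite -IHd addSn big_nat_recr ?leq_addl //=; last first.
  by rewrite -[X in (X < _)%N]addn0 -addnS leq_add2l.
by rewrite Fp addrC -big_ltn // -[X in (X < _)%N]addn0 ltn_add2l.
Qed.

(** * From a certificate to an identity of divisor sums *)

Section DivisorSums.
Variable C : numFieldType.
Implicit Types phi : nat -> nat -> C.

(** The diagonal term -(n/d - 1) phi'(d, d) splits in two: the part with n/d yields the [be] sum,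
    and the remaining phi'(d, d) joins the terms linear in d in the last hypothesis. *)
Lemma conv_divisor_sums p (chi chi' : int -> C) phi phi' (s : nat -> C) al be n :
  (0 < n)%N ->
  (forall a b, phi a b = phi' (a + b)%N a) ->
  (forall a b, phi a b = phi' b (a + b)%N) ->
  (forall a b, phi a b - phi' a b + (phi b a - phi' b a)
     = chi a%:Z * chi' b%:Z + chi b%:Z * chi' a%:Z) ->
  (forall d, phi' d d = - be * s d) ->
  (forall d, (0 < d)%N ->
     delta p chi 0 * chi' d%:Z + delta p chi' 0 * chi d%:Z
     + (\sum_(1 <= a < d) phi a (d - a)%N + phi' d d) = al * (s d * d%:R)) ->
  \sum_(j < n.+1) delta p chi j * delta p chi' (n - j)%N
  = al * (\sum_(d <- divisors n) s d * d%:R)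
    + be * (\sum_(d <- divisors n) s d * (n %/ d)%N%:R).
Proof.
move=> n0 phil phir phiE phid lin; rewrite delta_conv //.
have -> : \sum_(q <- quads n) chi q.1.1%:Z * chi' q.1.2%:Z
    = \sum_(q <- quads n) (phi q.1.1 q.1.2 - phi' q.1.1 q.1.2).
  (* The solution set is symmetric under swapping, so after doubling only symmetrised summands have
     to agree. *)
  apply: (@mulfI _ 2); rewrite ?pnatr_eq0 // !mulr_natl !mulr2n.
  pose f a b := chi a%:Z * chi' b%:Z; pose g a b := phi a b - phi' a b.
  rewrite {2}(quads_swap n f) {2}(quads_swap n g) -!big_split /=.
  by apply: eq_bigr => q _; rewrite /f /g phiE.
rewrite quads_three_term // -big_split /= !mulr_sumr -big_split /=.
apply: eq_big_seq => d; rewrite -dvdn_divisors // => dn.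
have d0 := dvdn_gt0 n0 dn.
have q0 : (0 < n %/ d)%N by rewrite divn_gt0 // dvdn_leq.
rewrite -lin // -[in RHS](prednK q0) -[(_.-1).+1]addn1 natrD -mulr_natr.
by rewrite phid; ring.
Qed.

(** Passing from d to d + p adds one full period of [phi] on the left and al s(d) p on the right, so
    d <= p and the p increments suffice. *)
Lemma lin_periodic p phi (L s : nat -> C) al :
  (0 < p)%N ->
  (forall a b, phi (a %% p)%N (b %% p)%N = phi a b) ->
  (forall d, L (d + p)%N = L d) -> (forall d, s (d + p)%N = s d) ->
  (forall d, (0 < d <= p)%N ->
     L d + \sum_(1 <= a < d) phi a (d - a)%N = al * (s d * d%:R)) ->
  (forall r, (r < p)%N ->
     \sum_(0 <= a < p) phi a (r + p - a)%N = al * (s r * p%:R)) ->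
  forall d, (0 < d)%N ->
     L d + \sum_(1 <= a < d) phi a (d - a)%N = al * (s d * d%:R).
Proof.
move=> p0 phip Lp sp base incr d.
have sr : forall e, s (e %% p)%N = s e.
  move=> e; rewrite [in RHS](divn_eq e p).
  elim: (e %/ p)%N => [|k IHk]; first by rewrite mul0n add0n.
  by rewrite mulSn -addnA addnC sp.
have [k] := ubnP d; elim: k d => // k IHk d dk d0.
have [dp|pd] := leqP d p; first by apply: base; rewrite d0.
set e := (d - p)%N; have de : d = (e + p)%N by rewrite subnK // ltnW.
have e0 : (0 < e)%N by rewrite subn_gt0.
rewrite de Lp sp (big_cat_nat (n := e)) ?leq_addr //=.
have -> : \sum_(1 <= a < e) phi a (e + p - a)%N = \sum_(1 <= a < e) phi a (e - a)%N.
  apply: eq_big_nat => a /andP[_ ae].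
  by rewrite -addnBAC ?(ltnW ae) // -phip modnDr phip.
have -> : \sum_(e <= a < e + p) phi a (e + p - a)%N = al * (s e * p%:R).
  rewrite -(sr e) -incr ?ltn_pmod //.
  (* Reducing a before subtracting makes [F] periodic on all of nat despite truncated
     subtraction. *)
  pose F a := phi (a %% p)%N (e %% p + (p - a %% p))%N.
  have Fp a : F (a + p)%N = F a by rewrite /F modnDr.
  transitivity (\sum_(0 <= a < p) F a); last first.
    apply: eq_big_nat => a /andP[_ ap]; rewrite /F modn_small //.
    by rewrite addnBA // ltnW.
  rewrite -(sum_periodic_shift e Fp); apply: eq_big_nat => a /andP[_ ae].
  rewrite /F -phip -[RHS]phip modn_mod; congr (phi _ _); apply/eqP.
  have Ea : (e %% p + (p - a %% p) + a = a %/ p * p + (e %% p + p))%N.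
    by have := ltn_pmod a p0; have := divn_eq a p; lia.
  by rewrite -(eqn_modDr a) subnK ?(ltnW ae) // Ea modnMDl !modnDr modn_mod.
rewrite addrA IHk //; last lia.
by rewrite natrD; ring.
Qed.

End DivisorSums.

Lemma delta0_geval (C : numFieldType) (I : C) (chi : int -> C) p (X : nat -> gint) :
  I * I = -1 -> (forall d : nat, chi d%:Z = geval I (X d)) ->
  delta p chi 0 = - geval I (gsum (fun a => gmul (X a) (gint_of a%:Z)) (iota 1 p.-1))
                    / (2 * p%:R).
Proof.
move=> sqrI chiX; rewrite /delta /= /index_iota subn1 geval_sum.
rewrite mulNr mul1r mulNr mulrC; congr (- (_ / _)); apply: eq_bigr => a _.
by rewrite gevalM // geval_int chiX.
Qed.

(** Half the table, extended to all arguments by reduction modulo p, is the required phi; by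
    periodicity the finitely many checks cover every n > 0. *)
Lemma quartic_cert_conv (C : numFieldType) (I : C) (chi chi' : int -> C) p
    (X Y : nat -> gint) (s : nat -> int) f A B n :
  I * I = -1 -> (0 < n)%N -> (0 < p)%N ->
  (forall d, X (d %% p)%N = X d) -> (forall d, Y (d %% p)%N = Y d) ->
  (forall d, s (d %% p)%N = s d) ->
  (forall d : nat, chi d%:Z = geval I (X d)) ->
  (forall d : nat, chi' d%:Z = geval I (Y d)) ->
  quartic_cert p X Y s f A B ->
  \sum_(j < n.+1) delta p chi j * delta p chi' (n - j)%N
  = geval I A / (2 * p%:R) * (\sum_(d <- divisors n) (s d)%:~R * d%:R)
    - geval I B / 2 * (\sum_(d <- divisors n) (s d)%:~R * (n %/ d)%N%:R).
Proof.
move=> sqrI n0 p0 Xp Yp sp chiX chiY; rewrite /quartic_cert; cbv zeta beta.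
set T := hom_table p s f; pose T' a b := T a (p - b)%N.
case/and4P => /allP tab /allP diag /allP lin /allP incr.
have pne : p%:R != 0 :> C by rewrite pnatr_eq0 -lt0n.
have gv := (gevalD I, gevalN I, gevalM sqrI, geval_int I, geval_sum I).
have rE a : (a %% p)%N \in iota 0 p by rewrite mem_iota ltn_pmod.
pose phi a b := geval I (T (a %% p) (b %% p))%N / 2.
pose phi' a b := geval I (T' (a %% p) (b %% p))%N / 2.
have tabE a b := and3P (allP (tab _ (rE a)) _ (rE b)).
rewrite -mulNr; apply: (@conv_divisor_sums C p chi chi' phi phi') => //.
- move=> a b; have [/eqP E _ _] := tabE a b.
  by rewrite /phi /phi' E modnDm.
- move=> a b; have [_ /eqP E _] := tabE a b.
  by rewrite /phi /phi' E modnDm.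
- move=> a b; have [_ _ /eqP/(congr1 (geval I))] := tabE a b.
  rewrite !gv -!chiX -!chiY /phi /phi' /T' => E.
  rewrite -!mulrBl -mulrDl E mulrAC divff ?pnatr_eq0 // mul1r.
  by rewrite !chiX !chiY !Xp !Yp.
- move=> d; have /eqP/(congr1 (geval I)) := diag _ (rE d).
  by rewrite !gv /phi' /T' sp => ->; rewrite opprK mulrAC.
move=> d d0; rewrite [\sum_(_ <= _ < _) _ + _]addrC addrA.
(* All terms that are p-periodic in d are collected in [L]. *)
pose L d := delta p chi 0 * chi' d%:Z + delta p chi' 0 * chi d%:Z + phi' d d.
apply: (@lin_periodic C p phi L (fun d => (s d)%:~R)) => //.
- by move=> a b; rewrite /phi !modn_mod.
- by move=> e; rewrite /L /phi' !chiX !chiY -Xp -Yp !modnDr Xp Yp.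
- by move=> e; rewrite -sp modnDr sp.
- move=> {d0}d /andP[d0 dp]; have din : d \in iota 1 p by rewrite mem_iota d0 add1n ltnS.
  have /eqP/(congr1 (geval I)) := lin _ din.
  rewrite !gv -!chiX -!chiY intrM => E.
  rewrite -[_ / _ * _]mulrAC -E /L.
  rewrite (delta0_geval p sqrI chiX) (delta0_geval p sqrI chiY) !geval_sum.
  have -> : \sum_(1 <= a < d) phi a (d - a)%N
      = (\sum_(a <- iota 1 d.-1) geval I (T a (d - a)%N)) / 2.
    rewrite mulr_suml /index_iota subn1; apply: eq_big_seq => a.
    rewrite mem_iota add1n prednK // => /andP[a0 ad].
    rewrite /phi !modn_small //; [lia|lia].
  rewrite -/T -/T' /phi'.
  by field; rewrite pne.
move=> r rp; have rin : r \in iota 0 p by rewrite mem_iota.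
have /eqP/(congr1 (geval I)) := incr _ rin; rewrite !gv => E.
have -> : \sum_(0 <= a < p) phi a (r + p - a)%N
    = (\sum_(a <- iota 0 p) geval I (T a ((r + p - a) %% p)%N)) / 2.
  rewrite mulr_suml /index_iota subn0; apply: eq_big_seq => a.
  by rewrite mem_iota /= => ap; rewrite /phi (modn_small ap).
by rewrite E; field; rewrite pne.
Qed.

(** * Dirichlet characters of order 4 *)

Section DirichletCharacters.
Variables (C : fieldType) (p : nat) (chi : int -> C).
Hypothesis chi_dir : dirichlet_character p chi.

Lemma dchar1 : chi 1 = 1.
Proof.
have [_ chiM chi0] := chi_dir.
have n0 : chi 1 != 0 by rewrite chi0 /coprimez gcd1z.
by apply: (mulfI n0); rewrite -chiM !mulr1.
Qed.

Lemma dcharX n k : chi (n ^+ k) = chi n ^+ k.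
Proof.
elim: k => [|k IHk]; first by rewrite !expr0 dchar1.
by rewrite !exprS (dchar_mul chi_dir) IHk.
Qed.

Lemma dchar_addM n (m : nat) : chi (n + (m * p)%N%:Z) = chi n.
Proof.
elim: m => [|m IHm]; first by rewrite mul0n addr0.
by rewrite mulSn addnC PoszD addrA (dchar_periodic chi_dir).
Qed.

Lemma dchar_eqmodn (m n : nat) : (m = n %[mod p])%N -> chi m%:Z = chi n%:Z.
Proof.
move=> mn; rewrite (divn_eq m p) (divn_eq n p) mn.
by rewrite ![(_ * p + _)%N]addnC !PoszD !dchar_addM.
Qed.

Lemma dchar_nat n : (0 < p)%N -> exists N : nat, chi n = chi N%:Z.
Proof.
move=> p0; exists (absz (n + (absz n * p)%N%:Z)).
have n0 : 0 <= n + (absz n * p)%N%:Z by nia.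
by rewrite gez0_abs // dchar_addM.
Qed.

Lemma dchar_prime_neq0 (n : nat) : prime p -> ~~ (p %| n)%N -> chi n%:Z != 0.
Proof.
by move=> pp pn; rewrite (dchar_support chi_dir) coprimezE /= coprime_sym prime_coprime.
Qed.

End DirichletCharacters.

Lemma sqr_eqN1_of_pow4 (C : fieldType) (z : C) : z ^+ 4 = 1 -> z ^+ 2 != 1 -> z ^+ 2 = -1.
Proof.
move=> z4 z2; apply/eqP; rewrite -subr_eq0 opprK.
have : (z ^+ 2 - 1) * (z ^+ 2 + 1) = 0 by rewrite -subr_sqr -exprM z4 expr1n subrr.
by move/eqP; rewrite mulf_eq0 subr_eq0 (negbTE z2).
Qed.

(* If u^2 = -1 mod p then (1 + u)^2 = 2u mod p, so chi(2)^2 chi(u)^2 = 1,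
   while chi(u)^2 = chi(-1) = -1. *)
Lemma dchar_order4_sqr2 (C : numFieldType) p (chi : int -> C) :
  prime p -> (p = 5 %[mod 8])%N -> dirichlet_character p chi ->
  dchar_order p chi 4 -> chi 2 ^+ 2 = -1.
Proof.
move=> pp p8 chid [_ chi4 chim].
have chi4n (n : nat) : ~~ (p %| n)%N -> chi n%:Z ^+ 4 = 1.
  move=> pn; rewrite chi4 /principal_char -(dchar_support chid).
  by rewrite (dchar_prime_neq0 chid).
have p1 := prime_gt1 pp.
(* Otherwise chi^2 would be principal, against the exact order 4. *)
have [n pn n2] : exists2 n : nat, ~~ (p %| n)%N & chi n%:Z ^+ 2 = -1.
  case: (boolP [exists n : 'I_p, ~~ (p %| n)%N && (chi n%:Z ^+ 2 != 1)]).
    move=> /existsP[n /andP[pn n2]]; exists n => //.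
    by apply: sqr_eqN1_of_pow4 => //; apply: chi4n.
  rewrite negb_exists => /forallP all1; case: (chim 2%N) => // m.
  rewrite /principal_char -(dchar_support chid).
  have [->|m0] := eqVneq (chi m) 0; first by rewrite expr0n.
  have [N mN] := dchar_nat chid m (ltnW p1).
  have rN : chi m = chi (N %% p)%N%:Z by rewrite mN; apply: (dchar_eqmodn chid); rewrite modn_mod.
  have := all1 (Ordinal (ltn_pmod N (ltnW p1))); rewrite /= -rN.
  have -> : ~~ (p %| N %% p)%N.
    move: m0; rewrite rN (dchar_support chid) coprimezE /=.
    by rewrite coprime_sym prime_coprime.
  by rewrite negbK => /eqP.
(* This is (p - 1) / 4, odd because p = 5 mod 8; so u = n^h keeps chi(u)^2 = -1 while u^4 = 1 modulo
   p. *)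
set h := (p %/ 8 * 2)%N.+1.
have ph : p = (h * 4).+1 by rewrite [LHS](divn_eq p 8) p8 /h; lia.
have hodd : odd h by rewrite /h /= oddM andbF.
have natX (a k : nat) : (a ^ k)%N%:Z = a%:Z ^+ k by rewrite -!natz natrX.
have neq1 : -1 != 1 :> C by rewrite -subr_eq0 -opprD oppr_eq0 (pnatr_eq0 C 2).
pose u := (n ^ h)%N.
have chiu2 : chi u%:Z ^+ 2 = -1.
  rewrite /u natX (dcharX chid) -exprM mulnC exprM n2.
  by rewrite -signr_odd hodd.
have u0 : (0 < u)%N by rewrite expn_gt0; case: (posnP n) pn => [->|//]; rewrite dvdn0.
have uk k : (0 < u ^ k)%N by rewrite (expn_gt0 u) u0.
(* u^2 = 1 modulo p would force chi(u)^2 = 1; so p divides the other factor u^2 + 1 of u^4 - 1. *)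
have u21 : ~~ (p %| u ^ 2 - 1)%N.
  rewrite -(eqn_mod_dvd p (uk 2)); apply/eqP => /(dchar_eqmodn chid).
  rewrite natX (dcharX chid) chiu2 (dchar1 chid) => /eqP.
  by rewrite (negbTE neq1).
have u2 : (p %| u ^ 2 + 1)%N.
  have : (p %| u ^ 4 - 1)%N.
    rewrite -(eqn_mod_dvd p (uk 4)) -expnM; apply/eqP.
    have -> : (h * 4 = totient p)%N by rewrite totient_prime // ph.
    by apply: Euler_exp_totient; rewrite coprime_sym prime_coprime.
  have -> : (u ^ 4 - 1 = (u ^ 2 - 1) * (u ^ 2 + 1))%N.
    by rewrite -subn_sqr -expnM exp1n.
  by rewrite Euclid_dvdM // (negbTE u21).
have pu1 : ~~ (p %| 1 + u)%N.
  apply: contra u21 => pu; rewrite -{2}(exp1n 2) subn_sqr dvdn_mull //.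
  by rewrite addnC.
have := chi4n _ pu1; rewrite (exprM _ 2 2) -(dcharX chid) -natX.
have -> : chi ((1 + u) ^ 2)%N%:Z = chi (2 * u)%N%:Z.
  apply: (dchar_eqmodn chid).
  have -> : ((1 + u) ^ 2 = (u ^ 2 + 1) + 2 * u)%N by rewrite !expnS expn0; lia.
  by rewrite -modnDml (eqP u2).
rewrite PoszM (dchar_mul chid) exprMn chiu2 mulrN1 => <-.
by rewrite opprK.
Qed.

Lemma quartic_modn p d : quartic p (d %% p) = quartic p d.
Proof. by rewrite /quartic /dvdn !modn_mod. Qed.

(** The last hypothesis says that 2 is a primitive root modulo p, so chi(2) determines chi. *)
Lemma dchar_quartic (C : numFieldType) p (chi : int -> C) :
  prime p -> dirichlet_character p chi -> chi 2 ^+ 2 = -1 ->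
  all (fun d => has (fun k => 2 ^ k == d %[mod p])%N (iota 0 p.-1)) (iota 1 p.-1) ->
  forall d : nat, chi d%:Z = geval (chi 2) (quartic p d).
Proof.
move=> pp chid chi2 /allP gen d; rewrite /geval /quartic.
case: ifPn => [pd|pd] /=.
  rewrite mul0r addr0; apply/eqP; rewrite -[_ == _]negbK (dchar_support chid).
  by rewrite coprimezE /= coprime_sym prime_coprime // pd.
have dr : (d %% p)%N \in iota 1 p.-1.
  by rewrite mem_iota lt0n pd add1n prednK ?prime_gt0 // ltn_pmod ?prime_gt0.
have := gen _ dr; set k := find _ _ => hk.
have {}hk : has (fun k => 2 ^ k == d %[mod p])%N (iota 0 p.-1).
  by move: hk; under eq_has do rewrite modn_mod.
have /eqP Ek := nth_find 0%N hk; rewrite -/k in Ek.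
have kp : (k < p.-1)%N by rewrite -[X in (_ < X)%N](size_iota 0) -has_find.
rewrite nth_iota // add0n in Ek.
rewrite -(dchar_eqmodn chid Ek).
have -> : (2 ^ k)%N%:Z = 2 ^+ k :> int by rewrite -[RHS]natrX natz.
rewrite (dcharX chid) {1}(divn_eq k 4) exprD [(_ * 4)%N]mulnC exprM.
have -> : chi 2 ^+ 4 = 1 by rewrite (exprM _ 2 2) chi2 sqrrN expr1n.
rewrite expr1n mul1r; have := ltn_pmod k (isT : (0 < 4)%N).
case: (k %% 4)%N => [|[|[|[|//]]]] _ /=.
- by rewrite mul0r addr0.
- by rewrite add0r mul1r.
- by rewrite chi2 mul0r addr0.
- by rewrite exprS chi2 add0r mulrC.
Qed.

(** * Quadratic reciprocity by Gauss sums *)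

(** In the field with q^(p-1) elements p divides the order of the unit group by Fermat, and Cauchy's
    theorem gives a unit of order p. *)
Lemma primitive_root_char (p q : nat) : prime p -> prime q -> p != q ->
  exists (L : finFieldType) (z : L), [/\ q \in [pchar L], z ^+ p = 1 & z != 1].
Proof.
move=> pp pq npq; have p1 := prime_gt1 pp.
have k0 : (0 < p.-1)%N by rewrite -ltnS prednK // ltnW.
have [L chL cardL] := pPrimePowerField pq k0; exists L.
have : (p %| #|[set: {unit L}]%G|)%N.
  rewrite /= card_finField_unit cardL -subn1 -eqn_mod_dvd ?expn_gt0 ?prime_gt0 //.
  rewrite -totient_prime // Euler_exp_totient // coprime_sym.
  by rewrite prime_coprime // dvdn_prime2.
case/(Cauchy pp) => x _ ordx; exists (FinRing.uval x); split=> //.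
  by rewrite -FinRing.val_unitX -ordx expg_order.
rewrite -FinRing.val_unit1 (inj_eq val_inj) -order_eq1 ordx.
by rewrite neq_ltn p1 orbT.
Qed.

(* The Gauss sum g of psi over a field of characteristic q satisfies g^2 = p
   and g^q = psi(q) g, so p is a square modulo q iff g lies in the prime field
   iff psi(q) = 1. The autocorrelation hypothesis is what makes g^2 = p. *)
Lemma legendre_reciprocity (p q : nat) (psi : nat -> int) :
  prime p -> prime q -> odd q -> p != q ->
  (forall a, psi (a %% p)%N = psi a) ->
  (forall a b, psi (a * b)%N = psi a * psi b) ->
  psi q ^+ 2 = 1 ->
  (forall c, (c < p)%N ->
    \sum_(0 <= a < p) psi a * psi (c + (p - a))%N = (c == 0)%N%:R * p%:Z - 1) ->
  legendre p q = psi q.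
Proof.
move=> pp pq oq npq psip psiM psiq2 corr.
have [L [z [chL zp z1]]] := primitive_root_char pp pq npq.
have p0 := prime_gt0 pp; have q0 := prime_gt0 pq.
have sumz : \sum_(0 <= c < p) z ^+ c = 0.
  rewrite big_mkord; apply/eqP; have := subrX1 z p; rewrite zp subrr => /esym/eqP.
  by rewrite mulf_eq0 subr_eq0 (negbTE z1).
pose F a := (psi a)%:~R * z ^+ a.
have psiD a : psi (a + p)%N = psi a by rewrite -psip modnDr psip.
have FD a : F (a + p)%N = F a by rewrite /F psiD exprD zp mulr1.
have Fmod a : F (a %% p)%N = F a.
  rewrite /F psip; congr (_ * _); rewrite [in RHS](divn_eq a p) exprD.
  by rewrite [(_ * p)%N]mulnC exprM zp expr1n mul1r.
pose g := \sum_(0 <= a < p) F a.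
have g2 : g ^+ 2 = p%:R.
  (* Substitute b = c + (p - a), so that a + b = c modulo p becomes the exponent of z. *)
  have gE a : (a < p)%N ->
      F a * g = \sum_(0 <= c < p) z ^+ c * (psi a * psi (c + (p - a))%N)%:~R.
    move=> ap; rewrite /g -(sum_periodic_shift (p - a) FD) mulr_sumr.
    rewrite -{1}[(p - a)%N]add0n [(p - a + p)%N]addnC big_addn addnK.
    apply: eq_bigr => c _; rewrite /F intrM.
    have -> : z ^+ c = z ^+ a * z ^+ (c + (p - a)).
      by rewrite -exprD addnCA subnKC ?(ltnW ap) // exprD zp mulr1.
    by ring.
  rewrite expr2 {1}/g mulr_suml.
  rewrite (eq_big_nat _ _ (F2 := fun a =>
      \sum_(0 <= c < p) z ^+ c * (psi a * psi (c + (p - a))%N)%:~R)); last first.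
    by move=> a /andP[_ ap]; apply: gE.
  rewrite exchange_big_nat /=.
  rewrite (eq_big_nat _ _ (F2 := fun c => (c == 0)%N%:R * p%:R - z ^+ c)); last first.
    move=> c /andP[_ cp]; rewrite -mulr_sumr.
    have -> : \sum_(0 <= a < p) (psi a * psi (c + (p - a))%N)%:~R
        = ((c == 0)%N%:R * p%:Z - 1)%:~R :> L by rewrite -corr // rmorph_sum.
    rewrite intrB intrM.
    by case: c {cp} => [|c]; rewrite /= ?expr0; ring.
  rewrite sumrB sumz subr0 big_ltn //= mul1r big_nat big1 ?addr0 //.
  by case=> [|c] //; rewrite mul0r.
(* Frobenius sends psi(a) z^a to psi(a) z^(a q), and a -> a q permutes the residues modulo p. *)
have gq : g ^+ q = (psi q)%:~R * g.
  rewrite -(pFrobenius_autE chL) /g rmorph_sum mulr_sumr.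
  under eq_bigr => a _ do rewrite rmorphM /= pFrobenius_aut_int pFrobenius_autE.
  have sh (a : 'I_p) : (a * q %% p < p)%N by rewrite ltn_pmod.
  have inj : injective (fun a => Ordinal (sh a)).
    move=> a b [] /eqP.
    wlog ba : a b / (b <= a)%N.
      by move=> H; case/orP: (leq_total a b) => /H + e => /(_ _)-> //; rewrite eq_sym.
    rewrite eqn_mod_dvd ?leq_mul2r ?ba ?orbT // -mulnBl Gauss_dvdl; last first.
      by rewrite prime_coprime // dvdn_prime2.
    by rewrite -eqn_mod_dvd // !modn_small // => /eqP/val_inj.
  rewrite !big_mkord [RHS](reindex_inj inj) /=; apply: eq_bigr => a _.
  have q1 : (psi q)%:~R * (psi q)%:~R = 1 :> L by rewrite -intrM -expr2 psiq2.
  by rewrite Fmod /F psiM intrM exprM; ring: q1.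
have natL (a b : nat) : (a%:R == b%:R :> L) = (a == b %[mod q])%N.
  wlog ba : a b / (b <= a)%N.
    by move=> H; case/orP: (leq_total a b) => /H // ; rewrite eq_sym [in RHS]eq_sym.
  by rewrite eqn_mod_dvd // (dvdn_pcharf chL) natrB // subr_eq0.
have pL : p%:R != 0 :> L by rewrite -(dvdn_pcharf chL) dvdn_prime2 // eq_sym.
have g0 : g != 0 by apply: contraNneq pL => g0; rewrite -g2 g0 expr0n.
have two0 : 2 != 0 :> L.
  by rewrite -(dvdn_pcharf chL 2) dvdn_prime2 //; apply: contraL oq => /eqP ->.
have psiqE : psi q = 1 \/ psi q = -1.
  move/eqP: psiq2; rewrite sqrf_eq1 => /orP[]/eqP; [by left|by right].
rewrite /legendre dvdn_prime2 // eq_sym (negbTE npq).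
(* If p = x^2 modulo q then g is x or -x, hence fixed by Frobenius, and psi(q) = -1 would give 2 g =
   0. *)
case: ifPn => [/existsP[x /eqP x2]|nx].
  case: psiqE => // psiqN; move: gq; rewrite psiqN.
  have : g ^+ 2 == x%:R ^+ 2 by rewrite g2 -natrX natL x2.
  rewrite eqf_sqr => xg.
  have -> : g ^+ q = g.
    rewrite -(pFrobenius_autE chL); case/orP: xg => /eqP ->.
      by rewrite pFrobenius_aut_nat.
    by rewrite pFrobenius_autN pFrobenius_aut_nat.
  rewrite mulN1r => /eqP; rewrite -subr_eq0 opprK -mulr2n -mulr_natl mulf_eq0.
  by rewrite (negbTE two0) (negbTE g0).
case: psiqE => // psiq1; case/negP: nx; move: gq; rewrite psiq1 mul1r => gq.
(* Now g is a root of X^q - X, whose roots are exhausted by the q elements of the prime field. *)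
pose rs := [seq x%:R : L | x <- iota 0 q].
have : g \in rs.
  apply: contraT => grs.
  have szP : size ('X^q - 'X : {poly L}) = q.+1.
    by rewrite size_polyDl size_polyXn // size_polyN size_polyX ltnS prime_gt1.
  have := @max_poly_roots L ('X^q - 'X) (g :: rs).
  rewrite -size_poly_eq0 szP /= grs size_map size_iota ltnn => /(_ isT) H.
  apply: H.
    rewrite rootE !hornerE gq subrr eqxx; apply/allP => y /mapP[x _ ->].
    by rewrite rootE !hornerE -(pFrobenius_autE chL) pFrobenius_aut_nat subrr.
  rewrite map_inj_in_uniq ?iota_uniq // => x y; rewrite !mem_iota /= => xq yq /eqP.
  by rewrite natL !modn_small // => /eqP.
case/mapP=> x; rewrite mem_iota => xq gx.
apply/existsP; exists (Ordinal (xq : (x < q)%N)) => /=.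
by rewrite -natL natrX -gx g2.
Qed.

(** The value -1 at 2 is that of (p / 2) for p = 5 mod 8; the last check is the autocorrelation
    behind the Gauss sum. *)
Definition quad_cert (p : nat) (psi : nat -> int) : bool :=
  [&& all (fun a => all (fun b => psi (a * b)%N == psi a * psi b) (iota 0 p)) (iota 0 p),
      psi 0%N == 0, psi 1%N == 1, psi 2%N == -1,
      all (fun a => psi a * psi a == 1) (iota 1 p.-1)
    & all (fun c => foldr (fun a z => psi a * psi (c + (p - a))%N + z) 0 (iota 0 p)
        == (c == 0)%N%:R * p%:Z - 1) (iota 0 p)].

(** By multiplicativity primes suffice: 2 is settled by p modulo 8, both sides vanish at p, and the
    other odd primes are reciprocity. The case d = 0 is separate. *)
Lemma kronecker_quad_cert p (psi : nat -> int) :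
  prime p -> (p = 5 %[mod 8])%N -> (forall a, psi (a %% p)%N = psi a) ->
  quad_cert p psi -> forall d, kronecker p d = psi d.
Proof.
move=> pp p8 psip /and5P[/allP mulP /eqP psi0 /eqP psi1 /eqP psi2 /andP[/allP sqP /allP corP]].
have p0 := prime_gt0 pp.
have rE a : (a %% p)%N \in iota 0 p by rewrite mem_iota ltn_pmod.
have psiM a b : psi (a * b)%N = psi a * psi b.
  have /eqP := allP (mulP _ (rE a)) _ (rE b).
  by rewrite !psip => <-; rewrite -psip -modnMm psip.
have psiX a k : psi (a ^ k)%N = psi a ^+ k.
  by elim: k => // k IHk; rewrite expnS exprS psiM IHk.
have podd : odd p by rewrite (divn_eq p 8) p8 oddD oddM andbF.
move=> d; rewrite /kronecker; have [->|d0] := eqVneq d 0%N.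
  by rewrite psi0; case: eqP pp => // ->.
have dE : d = (\prod_(q <- primes d) q ^ logn q d)%N.
  by rewrite {1}(prod_prime_decomp (_ : 0 < d)%N) ?lt0n // prime_decompE big_map.
rewrite [in RHS]dE (big_morph psi psiM psi1); apply: eq_big_seq => q.
rewrite mem_primes => /and3P[pq _ _]; rewrite psiX; congr (_ ^+ _).
rewrite /kronecker_prime; case: eqVneq => [->|q2].
  by rewrite podd p8 psi2.
have oq : odd q by case: (even_prime pq) q2 => [->|].
have [<-|npq] := eqVneq p q; first by rewrite /legendre dvdnn -psip modnn psi0.
apply: legendre_reciprocity => //.
  have rq : (q %% p)%N \in iota 1 p.-1.
    rewrite mem_iota add1n prednK // ltn_pmod // andbT lt0n.
    by rewrite -[_ == _]/(p %| q)%N dvdn_prime2.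
  by rewrite expr2 -psip; apply/eqP/(sqP _ rq).
move=> c cp; have cin : c \in iota 0 p by rewrite mem_iota.
rewrite -(eqP (corP _ cin)) /index_iota subn0.
by elim: (iota 0 p) => [|a l IHl]; rewrite ?big_nil // big_cons IHl.
Qed.

Lemma quad_char_modn p d : quad_char p (d %% p) = quad_char p d.
Proof. by rewrite /quad_char quartic_modn. Qed.

Lemma kronecker5 d : kronecker 5 d = quad_char 5 d.
Proof.
have cert : quad_cert 5 (quad_char 5) by vm_compute.
exact: (@kronecker_quad_cert 5 _ isT erefl (@quad_char_modn 5) cert).
Qed.

Lemma kronecker13 d : kronecker 13 d = quad_char 13 d.
Proof.
have cert : quad_cert 13 (quad_char 13) by vm_compute.
exact: (@kronecker_quad_cert 13 _ isT erefl (@quad_char_modn 13) cert).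
Qed.

(** * Constant terms and complex conjugation *)

(** Clearing denominators in B_2(x) = x^2 - x + 1/6 at x = a/p leaves an integer sum that can be
    computed. *)
Lemma gen_bernoulli2 (F : numFieldType) p (f : nat -> F) (psi : nat -> int) :
  (0 < p)%N -> (forall a, f a = (psi a)%:~R) ->
  gen_bernoulli 2 p f
  = (foldr (fun a z => psi a * (6 * a%:Z ^+ 2 - 6 * p%:Z * a%:Z + p%:Z ^+ 2) + z)
       0 (iota 1 p))%:~R / (6 * p%:R).
Proof.
move=> p0 fE; have pne : p%:R != 0 :> F by rewrite pnatr_eq0 -lt0n.
have b0 : bernoulli F 0 = 1.
  by have := bernoulli_rec F 0; rewrite big_ord1 bin0 mul1r.
have b1 : bernoulli F 1 = - (1 / 2).
  have := bernoulli_rec F 1; rewrite !big_ord_recl big_ord0 /= b0 /bump /= => H.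
  have E : 1 + 2 * bernoulli F 1 = 0 by move: H; rewrite addr0 mulr1.
  (* Adding -1/2 times the vanishing expression in [E] solves the recurrence; B_2 is found
     likewise. *)
  by rewrite -[LHS]addr0 -(mulr0 (- (1/2))) -E; field.
have b2 : bernoulli F 2 = 1 / 6.
  have := bernoulli_rec F 2; rewrite !big_ord_recl big_ord0 /= b0 /bump /= b1 => H.
  have E : 1 + 3 * - (1 / 2) + 3 * bernoulli F 2 = 0 by move: H; rewrite addr0 addrA mulr1.
  by rewrite -[LHS]addr0 -(mulr0 (- (1/3))) -E; field.
have polyE x : (bernoulli_poly F 2).[x] = x ^+ 2 - x + 1 / 6.
  rewrite /bernoulli_poly !big_ord_recl big_ord0 /bump /= b0 b1 b2 !hornerE.
  by rewrite -[LHS]/(x ^+ 2 + 2 * - 2^-1 * x + 6^-1 + 0); field.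
rewrite /gen_bernoulli /index_iota subn1 /=.
elim: (iota 1 p) => [|a l IHl] /=; first by rewrite big_nil mul0r mulr0.
rewrite big_cons mulrDr IHl intrD [RHS]mulrDl; congr (_ + _); rewrite polyE fE.
rewrite intrM !intrD intrN !intrM; field.
by rewrite pne.
Qed.

(** I has norm 1, so its conjugate is its inverse -I. *)
Lemma conj_of_sqrN1 (C : numClosedFieldType) (I : C) : I * I = -1 -> I^* = - I.
Proof.
move=> sqrI; have n1 : `|I| ^+ 2 = 1 by rewrite -normrX expr2 sqrI normrN1.
have I0 : I != 0 by apply: contra_eq_neq sqrI => ->; rewrite mulr0 eq_sym oppr_eq0 oner_eq0.
by apply: (mulfI I0); rewrite -normCK n1 mulrN sqrI opprK.
Qed.

Lemma geval_conj (C : numClosedFieldType) (I : C) z :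
  I * I = -1 -> (geval I z)^* = geval I (gconj z).
Proof.
move=> sqrI; rewrite /geval rmorphD rmorphM /= !rmorph_int (conj_of_sqrN1 sqrI).
by rewrite /gconj /= intrN mulrN mulNr.
Qed.

Lemma sigma'_triv_char (C : numFieldType) p n : (0 < n)%N ->
  sigma' C p n = \sum_(d <- divisors n) (triv_char p d)%:~R * d%:R.
Proof.
case: n => // n _; rewrite /sigma' /= big_mkcond; apply: eq_bigr => d _.
by rewrite /triv_char; case: ifP => /= pd; rewrite ?mul1r ?mul0r.
Qed.

Lemma triv_char_modn p d : triv_char p (d %% p) = triv_char p d.
Proof. by rewrite /triv_char /dvdn modn_mod. Qed.

Lemma cquartic_modn p d : cquartic p (d %% p) = cquartic p d.
Proof. by rewrite /cquartic quartic_modn. Qed.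

(** * Identities (I) and (II) from a certificate *)

Section Conv.
Variables (C : numClosedFieldType) (chi : int -> C) (I : C) (p : nat).
Hypothesis sqrI : I * I = -1.
Hypothesis chiX : forall d : nat, chi d%:Z = geval I (quartic p d).
Hypothesis p_gt0 : (0 < p)%N.
Hypothesis kron : forall d, kronecker p d = quad_char p d.

Let chibar (m : int) := (chi m)^*.
Let chibarX (d : nat) : chibar d%:Z = geval I (cquartic p d).
Proof. by rewrite /chibar chiX geval_conj. Qed.

Let c0 X := gsum (fun a => gmul (X a) (gint_of a%:Z)) (iota 1 p.-1).

(** The certificate gives n > 0; the last hypothesis is the case n = 0, with the constant terms
    cleared of denominators. As B = 0, no sum over n/d appears. *)
Lemma quartic_cert_I f A z n : c0 (quartic p) = z -> c0 (cquartic p) = gconj z ->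
  quartic_cert p (quartic p) (cquartic p) (triv_char p) f A (0, 0) ->
  geval I z * geval I (gconj z) / (2 * p%:R) = geval I A * ((p%:R - 1) / 24) ->
  \sum_(j < n.+1) delta p chi j * delta p chibar (n - j)%N
  = geval I A / (2 * p%:R) * sigma' C p n.
Proof.
move=> cz cz' cert E0; have pne : p%:R != 0 :> C by rewrite pnatr_eq0 -lt0n.
have [->|n0] := posnP n.
  rewrite big_ord1 subn0 (delta0_geval p sqrI chiX) (delta0_geval p sqrI chibarX).
  rewrite -/(c0 _) -/(c0 (cquartic p)) cz cz'.
  by rewrite [RHS]mulrAC /sigma' /= -E0; field.
rewrite sigma'_triv_char //.
rewrite (quartic_cert_conv sqrI n0 p_gt0 (@quartic_modn p) (@cquartic_modn p)
  (@triv_char_modn p) chiX chibarX cert).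
by rewrite geval0 !mul0r subr0.
Qed.

(** As sigma-hat vanishes at 0, the condition for n = 0 involves only A. *)
Lemma quartic_cert_II f A B z n : c0 (quartic p) = z ->
  quartic_cert p (quartic p) (quartic p) (quad_char p) f A B ->
  geval I z ^+ 2 / (2 * p%:R) = geval I A * sigma_tilde C p 0 ->
  \sum_(j < n.+1) delta p chi j * delta p chi (n - j)%N
  = geval I A / (2 * p%:R) * sigma_tilde C p n - geval I B / 2 * sigma_hat C p n.
Proof.
move=> cz cert E0; have pne : p%:R != 0 :> C by rewrite pnatr_eq0 -lt0n.
have [->|n0] := posnP n.
  rewrite big_ord1 subn0 (delta0_geval p sqrI chiX) -/(c0 _) cz.
  by rewrite [_ / _ * sigma_tilde _ _ _]mulrAC -E0 /sigma_hat /= mulr0 subr0; field.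
rewrite (quartic_cert_conv sqrI n0 p_gt0 (@quartic_modn p) (@quartic_modn p)
  (@quad_char_modn p) chiX chiX cert).
rewrite /sigma_tilde /sigma_hat (gtn_eqF n0).
by congr (_ * _ - _ * _); apply: eq_bigr => d _; rewrite kron.
Qed.

End Conv.

(** * Identity (I) forces p = 5 or p = 13 *)

Lemma identity_I_prime (C : numClosedFieldType) p (chi : int -> C) (A : C) :
  prime p -> (p = 5 %[mod 8])%N -> dirichlet_character p chi ->
  dchar_order p chi 4 ->
  (forall n, \sum_(j < n.+1) delta p chi j * delta p (fun m => (chi m)^*) (n - j)%N
     = A * sigma' C p n) ->
  p = 5%N \/ p = 13%N.
Proof.
move=> pp p8 chid chio HI.
have chi2 := dchar_order4_sqr2 pp p8 chid chio.
have [_ chi4 _] := chio.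
have p4 : (4 < p)%N.
  rewrite ltnNge; apply/negP => p4; move: pp p8.
  by case: p p4 {chid chio HI chi4} => [|[|[|[|[|]]]]].
have p1 : (p %| 1)%N = false by rewrite gtnNdvd //; lia.
have p2 : (p %| 2)%N = false by rewrite gtnNdvd //; lia.
have p3 : (p %| 3)%N = false by rewrite gtnNdvd //; lia.
have chi34 : chi 3 ^+ 4 = 1.
  rewrite chi4 /principal_char -(dchar_support chid).
  by rewrite (dchar_prime_neq0 chid (n := 3)) // p3.
set I := chi 2 in chi2 *; set w := chi 3 in chi34.
have sqrI : I * I = -1 by rewrite -expr2.
have Ic := conj_of_sqrN1 sqrI.
have wE : [\/ w = 1, w = -1, w = I | w = - I].
  have : (w - 1) * (w + 1) * ((w - I) * (w + I)) = 0.
    have -> : (w - 1) * (w + 1) * ((w - I) * (w + I)) = (w ^+ 2 - 1) * (w ^+ 2 - I * I) by ring.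
    by rewrite sqrI opprK -subr_sqr -exprM chi34 expr1n subrr.
  move/eqP; rewrite !mulf_eq0 !subr_eq0 !addr_eq0.
  by case/orP=> /orP[]/eqP; [apply: Or41|apply: Or42|apply: Or43|apply: Or44].
pose chb := (fun m : int => (chi m)^*).
have {}HI n : \sum_(j < n.+1) delta p chi j * delta p chb (n - j)%N
    = A * sigma' C p n by exact: HI.
pose b := delta p chi 0; pose c := delta p chb 0.
have c1 : chi 1 = 1 := dchar1 chid.
have cb1 : chb 1 = 1 by rewrite /chb c1 rmorph1.
have d1 g : delta p g 1 = g 1 :> C by rewrite /delta /= /divisors /= big_seq1.
have d2 g : delta p g 2 = g 1 + g 2 :> C.
  by rewrite /delta /= (_ : divisors 2 = [:: 1; 2]%N) // big_cons big_seq1.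
have d3 g : delta p g 3 = g 1 + g 3 :> C.
  by rewrite /delta /= (_ : divisors 3 = [:: 1; 3]%N) // big_cons big_seq1.
have s1 : sigma' C p 1 = 1.
  by rewrite /sigma' /= (_ : divisors 1 = [:: 1]%N) // big_cons big_nil p1 addr0.
have s2 : sigma' C p 2 = 3.
  rewrite /sigma' /= (_ : divisors 2 = [:: 1; 2]%N) // !big_cons big_nil p1 p2 /=.
  by ring.
have s3 : sigma' C p 3 = 4.
  rewrite /sigma' /= (_ : divisors 3 = [:: 1; 3]%N) // !big_cons big_nil p1 p3 /=.
  by ring.
have e0 : b * c = A * ((p%:R - 1) / 24).
  by have := HI 0%N; rewrite big_ord1.
have e1 : b + c = A.
  have := HI 1%N; rewrite !big_ord_recl big_ord0 /= s1 !d1 c1 cb1 -/b -/c.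
  by rewrite !mulr1 mul1r addr0.
have e2 : b * (1 - I) + 1 + (1 + I) * c = 3 * A.
  have := HI 2%N; rewrite !big_ord_recl big_ord0 /= s2 /bump /= !d1 !d2 c1 cb1.
  by rewrite /chb -/I Ic -/b -/c => E; rewrite [RHS]mulrC -E; ring.
have e3 : b * (1 + w^*) + 2 + (1 + w) * c = 4 * A.
  have := HI 3%N; rewrite !big_ord_recl big_ord0 /= s3 /bump /= !d1 !d2 !d3 c1 cb1.
  by rewrite /chb -/I Ic -/w -/b -/c => E; rewrite [RHS]mulrC -E; ring.
(* The coefficients at 0, 1, 2 tie p to A: b + c = A, I (c - b) = 2 A - 1, and 4 b c = (b + c)^2 +
   (I (c - b))^2. *)
have e4 : 5 * A ^+ 2 - 4 * A + 1 = A * (p%:R - 1) / 6.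
  have -> : A * (p%:R - 1) / 6 = 4 * (b * c) by rewrite e0; field.
  have E : I * (c - b) = 2 * A - 1.
    have -> : 2 * A - 1 = 3 * A - A - 1 by ring.
    by rewrite -e2 -e1; ring.
  have -> : 4 * (b * c) = (b + c) ^+ 2 + (I * (c - b)) ^+ 2 by ring: sqrI.
  by rewrite E e1; ring.
have sixn0 : 6 != 0 :> C by rewrite pnatr_eq0.
have solve (x : C) m : A = x -> x != 0 ->
    5 * x ^+ 2 - 4 * x + 1 = x * (m%:R - 1) / 6 -> p = m.
  move=> Ax x0 Ex; move: e4; rewrite Ax Ex => /(mulIf (invr_neq0 sixn0)).
  by move=> /(mulfI x0)/addIr/eqP; rewrite eqr_nat => /eqP.
have solve2 (k x : C) : k != 0 -> k * A = k * x -> A = x by move=> k0 /(mulfI k0).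
have two0 : 2 != 0 :> C by rewrite pnatr_eq0.
have five0 : 5 != 0 :> C by rewrite pnatr_eq0.
have fr0 : 3 / 5 != 0 :> C by rewrite mulf_neq0 ?invr_eq0 ?pnatr_eq0.
(* [e3] is combined with [e1] for chi(3) = 1, with [e2] for chi(3) = I and with both for chi(3) =
   -I, giving A = 1, 1 and 3/5. For chi(3) = -1 it reads 2 = 4 A, and A = 1/2 would give p = 4. *)
case: wE => wE; rewrite wE ?rmorphN ?rmorph1 /= ?Ic in e3.
- right; apply: (solve 1); rewrite ?oner_eq0 //; last by field.
  apply: (solve2 2) => //.
  have -> : 2 * A = 4 * A - 2 * A by ring.
  by rewrite -e3 -e1; ring.
- have A12 : A = 1 / 2.
    apply: (solve2 4); rewrite ?pnatr_eq0 //.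
    by rewrite -e3; field.
  have p4E : p = 4%N.
    by apply: (solve (1 / 2)) => //; [rewrite mulf_neq0 ?oner_eq0 ?invr_eq0|field].
  by move: p4; rewrite p4E.
- right; apply: (solve 1); rewrite ?oner_eq0 //; last by field.
  have -> : A = 4 * A - 3 * A by ring.
  by rewrite -e3 -e2; ring.
- left; apply: (solve (3 / 5)) => //; last by field.
  apply: (solve2 5) => //.
  have -> : 5 * A = 4 * A + 3 * A - 2 * A by ring.
  by rewrite -e3 -e2 -e1; field.
Qed.

Lemma sigma_tilde0 (C : numFieldType) p (B : int) : (0 < p)%N ->
  (forall d, kronecker p d = quad_char p d) ->
  foldr (fun a z => quad_char p a * (6 * a%:Z ^+ 2 - 6 * p%:Z * a%:Z + p%:Z ^+ 2) + z)
    0 (iota 1 p) = B ->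
  sigma_tilde C p 0 = - (1 / 4) * (B%:~R / (6 * p%:R)).
Proof.
move=> p0 kron <-; rewrite /sigma_tilde /= (gen_bernoulli2 (psi := quad_char p)) //.
by move=> a; rewrite kron.
Qed.


(** * The identities for p = 5 *)

Lemma pow2_generates5 :
  all (fun d => has (fun k => 2 ^ k == d %[mod 5])%N (iota 0 4)) (iota 1 4).
Proof. by vm_compute. Qed.

(** Hence delta(0) = (3 + chi(2)) / 10. *)
Lemma quartic5_moment :
  gsum (fun a => gmul (quartic 5 a) (gint_of a%:Z)) (iota 1 4) = (-3, -1).
Proof. by vm_compute. Qed.

Lemma cquartic5_moment :
  gsum (fun a => gmul (cquartic 5 a) (gint_of a%:Z)) (iota 1 4) = gconj (-3, -1).
Proof. by vm_compute. Qed.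

(** Hence B_{2,psi} = 24 / 30 = 4/5. *)
Lemma quad_char5_moment :
  foldr (fun a z => quad_char 5 a * (6 * a%:Z ^+ 2 - 6 * 5%N%:Z * a%:Z + 5%N%:Z ^+ 2) + z)
    0 (iota 1 5) = 24.
Proof. by vm_compute. Qed.

Lemma quartic_cert_I5 :
  quartic_cert 5 (quartic 5) (cquartic 5) (triv_char 5) table_I5 (6, 0) (0, 0).
Proof. by vm_compute. Qed.

Lemma quartic_cert_II5 :
  quartic_cert 5 (quartic 5) (quartic 5) (quad_char 5) table_II5 (-4, -3) (-2, -1).
Proof. by vm_compute. Qed.

Lemma identities5 (C : numClosedFieldType) (chi : int -> C) n :
  dirichlet_character 5 chi -> dchar_order 5 chi 4 ->
  \sum_(j < n.+1) delta 5 chi j * delta 5 (fun m => (chi m)^*) (n - j)%N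
  = 3 / 5 * sigma' C 5 n
  /\
  \sum_(j < n.+1) delta 5 chi j * delta 5 chi (n - j)%N
  = - ((4 + 3 * chi 2) / 10) * sigma_tilde C 5 n
    + (2 + chi 2) / 2 * sigma_hat C 5 n.
Proof.
move=> chid chio.
have chi2 : chi 2 ^+ 2 = -1 by exact: dchar_order4_sqr2 chid chio.
have sqrI : chi 2 * chi 2 = -1 by rewrite -expr2.
have chiX := @dchar_quartic _ 5 _ isT chid chi2 pow2_generates5.
have st0 := sigma_tilde0 C (isT : (0 < 5)%N) kronecker5 quad_char5_moment.
split.
  rewrite (quartic_cert_I sqrI chiX (isT : (0 < 5)%N) n quartic5_moment
    cquartic5_moment quartic_cert_I5); last by rewrite /geval /gconj /=; field: sqrI.
  by congr (_ * _); rewrite /geval /=; field.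
rewrite (quartic_cert_II sqrI chiX (isT : (0 < 5)%N) kronecker5 n quartic5_moment
  quartic_cert_II5); last by rewrite st0 /geval /=; field: sqrI.
by rewrite -mulNr; congr (_ * _ + _ * _); rewrite /geval /=; field.
Qed.

(** * The identities for p = 13 *)

Lemma pow2_generates13 :
  all (fun d => has (fun k => 2 ^ k == d %[mod 13])%N (iota 0 12)) (iota 1 12).
Proof. by vm_compute. Qed.

(** Hence delta(0) = (1 + chi(2)) / 2. *)
Lemma quartic13_moment :
  gsum (fun a => gmul (quartic 13 a) (gint_of a%:Z)) (iota 1 12) = (-13, -13).
Proof. by vm_compute. Qed.

Lemma cquartic13_moment :
  gsum (fun a => gmul (cquartic 13 a) (gint_of a%:Z)) (iota 1 12) = gconj (-13, -13).
Proof. by vm_compute. Qed.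

(** Hence B_{2,psi} = 312 / 78 = 4. *)
Lemma quad_char13_moment :
  foldr (fun a z => quad_char 13 a * (6 * a%:Z ^+ 2 - 6 * 13%N%:Z * a%:Z + 13%N%:Z ^+ 2) + z)
    0 (iota 1 13) = 312.
Proof. by vm_compute. Qed.

Lemma quartic_cert_I13 :
  quartic_cert 13 (quartic 13) (cquartic 13) (triv_char 13) table_I13 (26, 0) (0, 0).
Proof. by vm_compute. Qed.

Lemma quartic_cert_II13 :
  quartic_cert 13 (quartic 13) (quartic 13) (quad_char 13) table_II13 (0, -13) (-2, -3).
Proof. by vm_compute. Qed.

Lemma identities13 (C : numClosedFieldType) (chi : int -> C) n :
  dirichlet_character 13 chi -> dchar_order 13 chi 4 ->
  \sum_(j < n.+1) delta 13 chi j * delta 13 (fun m => (chi m)^*) (n - j)%N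
  = sigma' C 13 n
  /\
  \sum_(j < n.+1) delta 13 chi j * delta 13 chi (n - j)%N
  = - (chi 2 / 2) * sigma_tilde C 13 n
    + (2 + 3 * chi 2) / 2 * sigma_hat C 13 n.
Proof.
move=> chid chio.
have chi2 : chi 2 ^+ 2 = -1 by exact: dchar_order4_sqr2 chid chio.
have sqrI : chi 2 * chi 2 = -1 by rewrite -expr2.
have chiX := @dchar_quartic _ 13 _ isT chid chi2 pow2_generates13.
have st0 := sigma_tilde0 C (isT : (0 < 13)%N) kronecker13 quad_char13_moment.
split.
  rewrite (quartic_cert_I sqrI chiX (isT : (0 < 13)%N) n quartic13_moment
    cquartic13_moment quartic_cert_I13); last by rewrite /geval /gconj /=; field: sqrI.
  by rewrite -[RHS]mul1r; congr (_ * _); rewrite /geval /=; field.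
rewrite (quartic_cert_II sqrI chiX (isT : (0 < 13)%N) kronecker13 n quartic13_moment
  quartic_cert_II13); last by rewrite st0 /geval /=; field: sqrI.
by rewrite -mulNr; congr (_ * _ + _ * _); rewrite /geval /=; field.
Qed.

(** * The equivalence and the explicit coefficients *)

Theorem theorem1 (R : realType) (p : nat) (chi : int -> R[i])
    (p_prime : prime p) (p_mod8 : (p = 5 %[mod 8])%N)
    (chi_dirichlet : dirichlet_character p chi)
    (chi_order : dchar_order p chi 4) :
  let chibar := fun m : int => (chi m)^* in
  (((exists alpha : R, forall n : nat,
       \sum_(j < n.+1) delta p chi j * delta p chibar (n - j)%N
       = real_complex R alpha * sigma' R[i] p n)
    /\
    (exists alpha' beta' : R[i], forall n : nat,
       \sum_(j < n.+1) delta p chi j * delta p chi (n - j)%N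
       = alpha' * sigma_tilde R[i] p n + beta' * sigma_hat R[i] p n))
   <-> (p = 5%N \/ p = 13%N))
  /\
  (p = 5%N -> forall n : nat,
     \sum_(j < n.+1) delta p chi j * delta p chibar (n - j)%N
     = 3 / 5 * sigma' R[i] p n
     /\
     \sum_(j < n.+1) delta p chi j * delta p chi (n - j)%N
     = - ((4 + 3 * chi 2) / 10) * sigma_tilde R[i] p n
       + (2 + chi 2) / 2 * sigma_hat R[i] p n)
  /\
  (p = 13%N -> forall n : nat,
     \sum_(j < n.+1) delta p chi j * delta p chibar (n - j)%N
     = sigma' R[i] p n
     /\
     \sum_(j < n.+1) delta p chi j * delta p chi (n - j)%N
     = - (chi 2 / 2) * sigma_tilde R[i] p n
       + (2 + 3 * chi 2) / 2 * sigma_hat R[i] p n).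
Proof.
move=> chibar.
have H5 (e : p = 5%N) n := identities5 n
  (eq_ind p (fun q => dirichlet_character q chi) chi_dirichlet _ e)
  (eq_ind p (fun q => dchar_order q chi 4) chi_order _ e).
have H13 (e : p = 13%N) n := identities13 n
  (eq_ind p (fun q => dirichlet_character q chi) chi_dirichlet _ e)
  (eq_ind p (fun q => dchar_order q chi 4) chi_order _ e).
split; last by split=> pE n; rewrite pE; [exact: H5|exact: H13].
split=> [[[al HI] _]|pE].
  exact: identity_I_prime p_prime p_mod8 chi_dirichlet chi_order HI.
case: pE => pE; rewrite pE; split.
- exists (3 / 5) => n; rewrite (H5 pE n).1; congr (_ * _).
  by rewrite rmorphM fmorphV !rmorph_nat.
- by exists (- ((4 + 3 * chi 2) / 10)), ((2 + chi 2) / 2) => n; exact: (H5 pE n).2.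
- by exists 1 => n; rewrite (H13 pE n).1 rmorph1 mul1r.
- by exists (- (chi 2 / 2)), ((2 + 3 * chi 2) / 2) => n; exact: (H13 pE n).2.
Qed.
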